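(* In the setting described in the context, assume that for every Bohr frequency $\omega$ the operator $V_\omega$ is represented by a real matrix in the basis $(e_j)_{1\le j\le d}$ and $H_\omega$ is a linear combination of $V_\omega^*V_\omega$ and $V_\omega V_\omega^*$. Then the following are equivalent: 1. the quantum Markov semigroup generated by $\mathcal{L}$ satisfies the SQDB-$\Theta$ condition with respect to $\rho$; 2. for every Bohr frequency $\omega$, the quantum Markov semigroup generated by $\mathcal{L}_\omega$ admits $\rho$ as an invariant state and satisfies the SQDB-$\Theta$ condition with respect to $\rho$.
   Context: Setting. Let $\mathsf{h}$ be a complex Hilbert space of finite dimension $d$, $\mathcal{B}(\mathsf{h})$ the algebra of all operators on it, and $H_S=\sum_n\varepsilon_nP_{\varepsilon_n}$ a self-adjoint operator with distinct eigenvalues $\varepsilon_n$ and spectral projections $P_{\varepsilon_n}$. The Bohr frequencies are the (finitely many, distinct) numbers $\omega=\varepsilon_n-\varepsilon_m>0$. Fix an operator $V$ on $\mathsf{h}$ and put $V_\omega=\sum_{\varepsilon_n-\varepsilon_m=\omega}P_{\varepsilon_m}VP_{\varepsilon_n}$. For each Bohr frequency $\omega$ let $H_\omega$ be a self-adjoint operator commuting with $H_S$ and $\gamma^-_\omega,\gamma^+_\omega>0$, and define $$\mathcal{L}_\omega(x)=\mathrm{i}[H_\omega,x]-\tfrac{\gamma^-_\omega}{2}\left(V_\omega^*V_\omega x-2V_\omega^*xV_\omega+xV_\omega^*V_\omega\right)-\tfrac{\gamma^+_\omega}{2}\left(V_\omega V_\omega^*x-2V_\omega xV_\omega^*+xV_\omega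 V_\omega^*\right),$$ and $\mathcal{L}=\sum_\omega\mathcal{L}_\omega$. The quantum Markov semigroup (QMS) generated by $\mathcal{L}$ (resp. $\mathcal{L}_\omega$) is $(e^{t\mathcal{L}})_{t\ge0}$ (resp. $(e^{t\mathcal{L}_\omega})_{t\ge0}$) on $\mathcal{B}(\mathsf{h})$. The Kraus operators $(\gamma_\omega^-)^{1/2}V_\omega$, $(\gamma_\omega^+)^{1/2}V_\omega^*$ ($\omega$ Bohr frequency) are linearly independent; in particular $V_\omega\neq0$ for every $\omega$. A density matrix $\rho$ is an invariant state for a QMS $\mathcal{T}$ if $\mathrm{tr}(\rho\mathcal{T}_t(x))=\mathrm{tr}(\rho x)$ for all $x$ and $t\ge 0$. Let $\rho$ be a faithful invariant state for the QMS generated by $\mathcal{L}$, commuting with $H_S$, written $\rho=\sum_{1\le j\le d}\rho_j|e_j\rangle\langle e_j|$ with $\rho_j>0$, $\sum_j\rho_j=1$, where $(e_j)_{1\le j\le d}$ is an orthonormal basis of $\mathsf{h}$ and each $e_j$ is an eigenvector of $H_S$. The reversing map is the transpose $\Theta(x)=x^\intercal$ in the basis $(e_j)$. SQDB-$\Theta$ condition. A QMS $\mathcal{T}$ with faithful invariant state $\rho$ satisfies the standard quantum detailed balance condition with respect to the reversing operation $\Theta$ (SQDB-$\Theta$) if its dual maps $\mathcal{T}'_t$, defined by $\mathrm{tr}(\rho^{1/2}x\rho^{1/2}\mathcal{T}_t(y))=\mathrm{tr}(\rho^{1/2}\mathcal{T}'_t(x)\rho^{1/2}y)$ for all $x,y\in\mathcal{B}(\mathsf{h})$,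 satisfy $\mathcal{T}'_t=\Theta\circ\mathcal{T}_t\circ\Theta$ for all $t\ge0$. *)

(* Defs.v *)
From mathcomp Require Export all_boot all_order all_algebra.
From mathcomp Require Export all_classical all_reals all_analysis.
From mathcomp Require Export complex.

Export Order.TTheory GRing.Theory Num.Theory numFieldNormedType.Exports.

Set Implicit Arguments.
Unset Strict Implicit.
Unset Printing Implicit Defensive.

Local Open Scope classical_set_scope.
Local Open Scope ring_scope.
Local Open Scope complex_scope.
Local Open Scope sesquilinear_scope.

(* The Hilbert space is C^d (column vectors) with C = R[i]; operators on it are
   'M[R[i]]_d acting on the left, and the adjoint of x is x ^t*. *)

(* e^{tL}(x) = sum_k (t^k / k!) L^k(x), the limit being taken in the normed
   space of matrices. *)
Definition exp_semigroup (K : numFieldType) (d : nat)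
    (L : 'M[K]_d -> 'M[K]_d) (t : K) (x : 'M[K]_d) : 'M[K]_d :=
  limn (series (fun k : nat => (t ^+ k / k`!%:R) *: iter k L x)).

Section Setting.
Variables (R : realType) (d : nat).
Local Notation C := (R[i]).
Local Notation op := 'M[C]_d.
Implicit Types (e : 'I_d -> 'cV[C]_d) (x y V H rho : op).

Definition qms (L : op -> op) (t : R) : op -> op := exp_semigroup L t%:C.

(* Antilinear in the first argument. *)
Definition inner (u v : 'cV[C]_d) : C := (u ^t* *m v) 0 0.

Definition ketbra (u v : 'cV[C]_d) : op := u *m v ^t*.

Definition orthonormal_basis e : Prop :=
  forall j k, inner (e j) (e k) = (j == k)%:R.

Definition matrix_in e x : op := \matrix_(j, k) inner (e j) (x *m e k).

Definition transpose_in e x : op :=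
  \sum_j \sum_k (matrix_in e x)^T j k *: ketbra (e j) (e k).

Definition diag_in e (f : 'I_d -> R) : op :=
  \sum_j (f j)%:C *: ketbra (e j) (e j).

(* H = sum_n eps_n P_n with distinct eigenvalues eps_n; P n != 0 says that each
   eps n is attained. *)
Definition spectral_decomposition (N : nat) (eps : 'I_N -> R)
    (P : 'I_N -> op) H : Prop :=
  [/\ injective eps,
      forall n, P n \is hermsymmx /\ P n != 0,
      forall n m, P n *m P m = if n == m then P n else 0,
      \sum_n P n = 1%:M &
      H = \sum_n (eps n)%:C *: P n].

Definition bohr_frequencies (N : nat) (eps : 'I_N -> R) : seq R :=
  undup [seq w <- [seq eps n - eps m | n <- enum 'I_N, m <- enum 'I_N] | 0 < w].

Definition bohr_component (N : nat) (eps : 'I_N -> R) (P : 'I_N -> op) V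
    (w : R) : op :=
  \sum_n \sum_(m | eps n - eps m == w) P m *m V *m P n.

Definition gksl H V (gm gp : R) x : op :=
  'i%C *: (H *m x - x *m H)
  - (gm / 2)%:C *:
      (V ^t* *m V *m x - 2 *: (V ^t* *m x *m V) + x *m V ^t* *m V)
  - (gp / 2)%:C *:
      (V *m V ^t* *m x - 2 *: (V *m x *m V ^t*) + x *m V *m V ^t*).

Definition kraus (ws : seq R) (Vw : R -> op) (gm gp : R -> R) : seq op :=
  [seq (Num.sqrt (gm w))%:C *: Vw w | w <- ws] ++
  [seq (Num.sqrt (gp w))%:C *: (Vw w) ^t* | w <- ws].

Definition density_matrix rho : Prop :=
  [/\ rho \is hermsymmx,
      forall u, 0 <= inner u (rho *m u) &
      \tr rho = 1].

Definition invariant_state rho (T : R -> op -> op) : Prop :=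
  density_matrix rho /\
  forall (t : R) x, 0 <= t -> \tr (rho *m T t x) = \tr (rho *m x).

(* Here rho = diag_in e p, so that rho^{1/2} = diag_in e (sqrt o p). The dual
   maps T' are uniquely determined by the trace identity when all p j > 0. *)
Definition sqdb (Theta : op -> op) e (p : 'I_d -> R) (T : R -> op -> op)
    : Prop :=
  let rho_half := diag_in e (fun j => Num.sqrt (p j)) in
  exists T' : R -> op -> op,
    (forall t : R, 0 <= t -> forall x y,
       \tr (rho_half *m x *m rho_half *m T t y) =
       \tr (rho_half *m T' t x *m rho_half *m y)) /\
    (forall t : R, 0 <= t -> forall x, T' t x = Theta (T t (Theta x))).

End Setting.

(* Main.v *)
(* For the form (x, y) = tr (rho^1/2 x rho^1/2 y), which Theta preserves, the SQDB
   condition on the semigroup is equivalent, by differentiation at 0 and by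
   comparison of the power series, to a linear symmetry condition on the
   generator; hence the conditions on the L_w add up to the one on L.
   Conversely, test the symmetry of L on the rank-one projections onto two
   basis vectors e_k, e_a. As the e_j are eigenvectors of H_S, at most one V_w
   has a nonzero (a, k) entry, and for this w one finds the classical balance
   gm_w p_k = gp_w p_a. Thus rho^1/2 V_w = (gm_w / gp_w)^1/2 V_w rho^1/2, which
   gives the symmetry of L_w. Since L_w 1 = 0, symmetry implies invariance. *)

From HB Require Import structures.
From mathcomp Require Import ring.
Require Import Defs.

Set Implicit Arguments.
Unset Strict Implicit.
Unset Printing Implicit Defensive.

Local Open Scope classical_set_scope.
Local Open Scope ring_scope.
Local Open Scope complex_scope.
Local Open Scope sesquilinear_scope.

(** * Exponential series *)

Lemma trace_mul_sum (K : pzRingType) (n : nat) (A x : 'M[K]_n) :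
  \tr (A *m x) = \sum_i \sum_j A i j * x j i.
Proof. by apply: eq_bigr => i _; rewrite mxE. Qed.

Lemma trace_delta_mul (K : pzRingType) (n : nat) (x : 'M[K]_n) i j :
  \tr (delta_mx j i *m x) = x i j.
Proof.
rewrite trace_mul_sum (bigD1 j)//= (bigD1 i)//= !mxE !eqxx mul1r !big1 ?addr0//.
  by move=> a ne; rewrite big1// => b _; rewrite mxE (negPf ne) mul0r.
by move=> a ne; rewrite mxE (negPf ne) andbF mul0r.
Qed.

Section ExpSemigroup.
Variables (K : numFieldType) (d : nat).
Implicit Types (A x y : 'M[K]_d) (L : 'M[K]_d -> 'M[K]_d).

Lemma cvg_sum_fin (V : normedModType K) (I : finType) (f : I -> nat -> V) (a : I -> V) :
  (forall i, f i @ \oo --> a i) -> (fun n => \sum_i f i n) @ \oo --> \sum_i a i.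
Proof. by move=> fa; apply: cvg_big => //; exact: add_continuous. Qed.

(** Entrywise l1 norm. Being a sum of entries, it bounds a linear map directly through its values on
    the matrix units. *)
Definition mxl1 x : K := \sum_i \sum_j `|x i j|.

Lemma mxl1_ge0 x : 0 <= mxl1 x.
Proof. by apply: sumr_ge0 => i _; apply: sumr_ge0. Qed.

Lemma entry_le_mxl1 x i j : `|x i j| <= mxl1 x.
Proof.
rewrite /mxl1 (bigD1 i)//= (bigD1 j)//= -addrA lerDl addr_ge0//.
  by apply: sumr_ge0.
by do 2! (apply: sumr_ge0 => ? _).
Qed.

Lemma linear_delta_sum L x : linear L ->
  L x = \sum_i \sum_j x i j *: L (delta_mx i j).
Proof.
move=> linL.
pose hL := GRing.isLinear.Build _ _ _ _ L linL.
pose L' : {linear 'M[K]_d -> 'M[K]_d} := HB.pack L hL.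
rewrite {1}[x]matrix_sum_delta -[L]/(L' : _ -> _) linear_sum.
apply: eq_bigr => i _; rewrite linear_sum.
by apply: eq_bigr => j _; rewrite linearZ.
Qed.

Lemma mxl1_linear_le L : linear L ->
  exists2 r, 0 <= r & forall x, mxl1 (L x) <= r * mxl1 x.
Proof.
move=> linL; exists (\sum_i \sum_j mxl1 (L (delta_mx i j))).
  by do 2! (apply: sumr_ge0 => ? _); exact: mxl1_ge0.
move=> x; rewrite (linear_delta_sum _ linL).
have mxl1D y z : mxl1 (y + z) <= mxl1 y + mxl1 z.
  rewrite -big_split /=; apply: ler_sum => i _; rewrite -big_split /=.
  by apply: ler_sum => j _; rewrite mxE ler_normD.
have mxl10 : mxl1 0 = 0.
  by rewrite /mxl1 big1// => i _; rewrite big1// => j _; rewrite mxE normr0.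
have mxl1sum (I : finType) (F : I -> 'M[K]_d) :
    mxl1 (\sum_i F i) <= \sum_i mxl1 (F i).
  elim/big_ind2: _ => [|a b a' b' ab ab'|//]; first by rewrite mxl10.
  by apply: le_trans (mxl1D _ _) _; exact: lerD.
have mxl1Z a y : mxl1 (a *: y) = `|a| * mxl1 y.
  rewrite /mxl1 mulr_sumr; apply: eq_bigr => i _; rewrite mulr_sumr.
  by apply: eq_bigr => j _; rewrite mxE normrM.
apply: le_trans (mxl1sum _ _) _; rewrite mulr_suml; apply: ler_sum => i _.
apply: le_trans (mxl1sum _ _) _; rewrite mulr_suml; apply: ler_sum => j _.
by rewrite mxl1Z mulrC ler_wpM2l ?mxl1_ge0 ?entry_le_mxl1.
Qed.

(** Geometric growth makes the exponential series converge and later controls its terms of order at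
    least 2. With a matrix unit for [A], it bounds a single entry of the iterates. *)
Lemma trace_iter_le L A y : linear L ->
  exists M r, [/\ 0 <= M, 0 <= r &
    forall k, `|\tr (A *m iter k L y)| <= M * r ^+ k].
Proof.
move=> /mxl1_linear_le[r r0 Lr]; exists (mxl1 A * mxl1 y), r.
split=> // [|k]; first by rewrite mulr_ge0 ?mxl1_ge0.
have itk : mxl1 (iter k L y) <= mxl1 y * r ^+ k.
  elim: k => [|k IHk]; first by rewrite expr0 mulr1.
  rewrite iterS; apply: le_trans (Lr _) _.
  by rewrite exprS mulrCA ler_wpM2l.
rewrite -mulrA; apply: le_trans (_ : mxl1 A * mxl1 (iter k L y) <= _); last first.
  by rewrite ler_wpM2l ?mxl1_ge0.
rewrite trace_mul_sum mulr_suml; apply: le_trans (ler_norm_sum _ _ _) _.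
apply: ler_sum => i _; rewrite mulr_suml; apply: le_trans (ler_norm_sum _ _ _) _.
by apply: ler_sum => j _; rewrite normrM ler_wpM2l ?entry_le_mxl1.
Qed.

(* R[i] has a topology only through its cast to numFieldType; this property is all
   that is needed of its completeness. *)
Definition exp_complete := forall (c : nat -> K) (M r : K), 0 <= r ->
  (forall k, `|c k| <= M * (r ^+ k / k`!%:R)) -> cvgn (series c).

Hypothesis Kexp : exp_complete.

Lemma cvg_exp_term (c : nat -> K) (M r t : K) : 0 <= r ->
  (forall k, `|c k| <= M * r ^+ k) ->
  cvgn (series (fun k => t ^+ k / k`!%:R * c k)).
Proof.
move=> r0 cle; apply: (@Kexp _ M (`|t| * r)); first by rewrite mulr_ge0.
move=> k; rewrite normrM normrM normrX normfV normr_nat exprMn.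
rewrite [leRHS](_ : _ = `|t| ^+ k / k`!%:R * (M * r ^+ k)); last by ring.
by rewrite ler_wpM2l// mulr_ge0 ?invr_ge0 ?exprn_ge0.
Qed.

(** [limn] is a genuine limit only once convergence is known. Convergence is obtained entry by entry
    and reassembled from the matrix units. *)
Lemma exp_semigroup_cvg L t y : linear L ->
  series (fun k => (t ^+ k / k`!%:R) *: iter k L y) @ \oo --> exp_semigroup L t y.
Proof.
move=> linL; suff : cvgn (series (fun k => (t ^+ k / k`!%:R) *: iter k L y)) by [].
rewrite [X in cvgn X](_ : _ = (fun n => \sum_i \sum_j
   series (fun k => t ^+ k / k`!%:R * iter k L y i j) n *: delta_mx i j)); last first.
  apply/funext => n; rewrite [LHS]matrix_sum_delta.
  apply: eq_bigr => i _; apply: eq_bigr => j _; congr (_ *: _).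
  by rewrite summxE; apply: eq_bigr => k _; rewrite mxE.
have entry_cvg i j : cvgn (series (fun k => t ^+ k / k`!%:R * iter k L y i j)).
  have [M [r [_ r0 bound]]] := trace_iter_le (delta_mx j i) y linL.
  apply: cvg_exp_term r0 _ => k; apply: le_trans (bound k).
  by rewrite trace_delta_mul.
apply/cvg_ex; eexists; apply: cvg_sum_fin => i; apply: cvg_sum_fin => j.
by apply: cvgZr_tmp; exact: entry_cvg.
Qed.

(** The trace against [A] is a finite combination of entries, so the limit passes through it.
    Afterwards only scalar power series are needed. *)
Lemma exp_semigroup_trace_cvg L t A y : linear L ->
  series (fun k => t ^+ k / k`!%:R * \tr (A *m iter k L y)) @ \oo -->
    \tr (A *m exp_semigroup L t y).
Proof.
move=> /(@exp_semigroup_cvg _ t y); set u := series _ => ucvg.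
rewrite trace_mul_sum [X in X @ _ --> _](_ : _ = (fun n =>
  \sum_i \sum_j A i j * u n j i)); last first.
  apply/funext => n; rewrite -trace_mul_sum mulmx_sumr raddf_sum.
  by apply: eq_bigr => k _ /=; rewrite -scalemxAr mxtraceZ.
apply: cvg_sum_fin => i; apply: cvg_sum_fin => j; apply: cvgMl_tmp.
have := @coord_continuous K d d j i (exp_semigroup L t y).
by move=> /(cvg_comp _ _ ucvg).
Qed.

(** Differentiation at 0 by hand: [t = 0] gives [b 0 = 0], and for [0 <= t <= 1] the terms of order
    at least 2 add up to at most [t ^+ 2 * D], too little to cancel [t * b 1] when [t] is small. *)
Lemma exp_series_coef1_eq0 (b : nat -> K) (M r : K) : 0 <= r ->
  (forall k, `|b k| <= M * r ^+ k) ->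
  (forall t, 0 <= t -> series (fun k => t ^+ k / k`!%:R * b k) @ \oo --> 0) ->
  b 1%N = 0.
Proof.
move=> r0 ble bcvg.
have [D D0 Dge] : exists2 D : K, 0 <= D & forall n, \sum_(k < n) `|b k| / k`!%:R <= D.
  have /cvg_seq_bounded : cvgn (series (fun k => `|b k| / k`!%:R)).
    apply: (@Kexp _ M r) => // k.
    by rewrite normrM normfV normr_nat normr_id mulrA ler_wpM2r ?invr_ge0.
  move=> /pinfty_ex_gt0[D D0 Dle]; exists D => [|n]; first exact: ltW.
  have := Dle n Logic.I; rewrite /series /= big_mkord => nD.
  apply: le_trans nD; rewrite ger0_norm//.
  by apply: sumr_ge0 => k _; rewrite mulr_ge0 ?invr_ge0.
have b0 : b 0%N = 0.
  apply/eqP/negPn/negP => b0.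
  have /cvgrPdist_lt/(_ `|b 0%N|) := bcvg 0 (lexx 0).
  rewrite normr_gt0 => /(_ b0) [n _ /(_ n.+1 (leqnSn n))] /=.
  rewrite /series /= big_mkord big_ord_recl /= expr0 fact0 divr1 mul1r.
  rewrite big1 ?addr0 ?sub0r ?normrN ?ltxx// => k _.
  by rewrite /bump /= add1n expr0n /= !mul0r.
apply/eqP/negPn/negP => b1; rewrite -normr_gt0 in b1.
(* [t] is chosen such that [t ^+ 2 * (1 + D) < t * `|b 1|]. *)
pose t := `|b 1%N| / (`|b 1%N| + 1 + D).
have den0 : 0 < `|b 1%N| + 1 + D by rewrite ltr_wpDr// addr_gt0.
have t0 : 0 < t by rewrite divr_gt0.
have t1 : t <= 1 by rewrite ler_pdivrMr// mul1r -addrA lerDl addr_ge0.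
(* The tolerance [t ^+ 2] accounts for the 1 in [1 + D]. Taking at least [n.+2] terms lets the
   coefficients 0 and 1 be split off, so that [tail] starts at order 2. *)
have /cvgrPdist_lt/(_ (t ^+ 2)) := bcvg t (ltW t0).
rewrite exprn_gt0// => /(_ isT) [n _ /(_ n.+2)] /=.
rewrite (leq_trans (leqnSn n)) // => /(_ isT).
rewrite /series /= big_mkord !big_ord_recl /= b0 mulr0 !add0r normrN.
rewrite expr1 divr1 /bump /=.
set tail := \sum_(i < n) _ => small.
have tail_le : `|tail| <= t ^+ 2 * D.
  apply: le_trans (ler_norm_sum _ _ _) _.
  have := Dge n.+2; rewrite !big_ord_recl /= => Dn.
  apply: le_trans (_ : t ^+ 2 * \sum_(i < n) `|b i.+2| / i.+2`!%:R <= _).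
    rewrite mulr_sumr; apply: ler_sum => i _.
    rewrite /bump /= !add1n normrM normrM normfV normr_nat normrX (ger0_norm (ltW t0)).
    rewrite [leRHS](_ : _ = t ^+ 2 / i.+2`!%:R * `|b i.+2|); last by ring.
    rewrite ler_wpM2r// ler_wpM2r ?invr_ge0// -addn2 exprD ler_piMl ?exprn_ge0 ?(ltW t0)//.
    by rewrite exprn_ile1 ?(ltW t0).
  rewrite ler_wpM2l ?exprn_ge0 ?(ltW t0)//; apply: le_trans Dn.
  rewrite addrA lerDr addr_ge0 // mulr_ge0 ?invr_ge0//.
have : t * `|b 1%N| < t * (t * (1 + D)).
  rewrite -[t in t * `|_|](ger0_norm (ltW t0)) -normrM.
  rewrite [ltRHS](_ : _ = t ^+ 2 + t ^+ 2 * D); last by ring.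
  rewrite -[X in `|X|](addrK tail); apply: le_lt_trans (ler_normB _ _) _.
  exact: ltr_leD.
(* After cancelling [t], clearing the denominator and cancelling [b 1], the inequality reads
   [|b 1| + 1 + D < 1 + D]. *)
rewrite ltr_pM2l// /t mulrAC ltr_pdivlMr// ltr_pM2l//.
by rewrite -addrA gtrDr lt_gtF.
Qed.

End ExpSemigroup.

Lemma cvg_linear_combination (K : numFieldType) (f g : nat -> K) (a b k : K) :
  f @ \oo --> a -> g @ \oo --> b ->
  (fun n => f n + k * g n) @ \oo --> a + k * b.
Proof. by move=> fa gb; apply: cvgD => //; apply: cvgM => //; exact: cvg_cst. Qed.

Lemma cvg_series_sub0 (K : numFieldType) (u v w : nat -> K) (l l' : K) :
  (forall k, w k = u k - v k) -> l = l' ->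
  series u @ \oo --> l -> series v @ \oo --> l' -> series w @ \oo --> (0 : K).
Proof.
move=> wuv <- ul vl; rewrite -(subrr l) (_ : series w = series u - series v).
  exact: cvgB.
by apply/funext => n; rewrite /series /= fctE -sumrB; apply: eq_bigr.
Qed.

Lemma cvg_series_unique (K : numFieldType) (u v : nat -> K) (l l' : K) :
  u =1 v -> series u @ \oo --> l -> series v @ \oo --> l' -> l = l'.
Proof.
by move=> /funext <- ul vl; apply: (cvg_unique _ ul) => //; exact: norm_hausdorff.
Qed.

Lemma cvg_series_head (K : numFieldType) (u : nat -> K) (l : K) :
  (forall k, u k.+1 = 0) -> series u @ \oo --> l -> l = u 0%N.
Proof.
move=> u0; have : series u @ \oo --> u 0%N.
  apply: cvg_near_cst; exists 1%N => // -[//|n] _ /=.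
  by rewrite /series /= big_mkord big_ord_recl big1 ?addr0// => k _; exact: u0.
by move=> h1 h2; apply: (cvg_unique _ h2 h1); exact: norm_hausdorff.
Qed.

(** * Convergence of exponential series over the complex numbers *)

Section ComplexSeries.
Variable R : realType.
Local Notation C := (R[i] : numFieldType).

Lemma real_complex_cvg (T : Type) (F : set_system T) (FF : Filter F)
    (f : T -> R) (a : R) :
  f @ F --> a -> (fun x => (f x)%:C : C) @ F --> (a%:C : C).
Proof.
(* A positive element of [R[i]] has zero imaginary part, so [er] serves as the real tolerance. *)
move=> /cvgrPdist_lt fa; apply/cvgrPdist_lt => -[er ei].
rewrite ltcE /= => /andP[/eqP -> er_gt0].
apply: filterS (fa _ er_gt0) => x; rewrite -rmorphB /= normc_def /=.
by rewrite expr0n addr0 sqrtr_sqr ltcR.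
Qed.

(** The real and imaginary parts are dominated by [b], hence converge absolutely in the complete
    field [R]; their limits are then recombined. *)
Lemma complex_series_cvg (c : nat -> C) (b : R ^nat) :
  (forall k, `|c k| <= (b k)%:C) -> cvgn (series b) -> cvgn (series c).
Proof.
move=> cb bcvg.
have part (f : C -> R) : (forall z, `|f z|%:C <= `|z|) ->
    cvgn (series (f \o c)).
  move=> fle; apply: normed_cvg; apply: series_le_cvg bcvg => k //=.
    by rewrite -ler0c; exact: le_trans (cb k).
  by rewrite -lecR; exact: le_trans (fle _) (cb k).
(* Multiplication by the imaginary unit reduces the bound to the one for real parts. *)
have Imle (z : C) : `|complex.Im z|%:C <= `|z|.
  have := normc_ge_Re (z * 'i%C).
  rewrite ReiNIm normrN normrM [`|'i%C|]normc_def /= expr0n expr1n add0r.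
  by rewrite sqrtr1 mulr1.
have /cvg_ex[a /real_complex_cvg ca] := part _ (@normc_ge_Re _).
have /cvg_ex[b' /real_complex_cvg cb'] := part _ Imle.
apply/cvg_ex; exists (a%:C + 'i%C * b'%:C).
have -> : series c = (fun n => (series (@complex.Re R \o c) n)%:C +
   'i%C * (series (@complex.Im R \o c) n)%:C).
  apply/funext => n; rewrite /series /= !rmorph_sum mulr_sumr -big_split /=.
  by apply: eq_bigr => k _; exact: complexE.
exact: (@cvg_linear_combination C _ _ _ _ 'i%C ca cb').
Qed.

Lemma complex_exp_series_cvg (c : nat -> C) (M r : C) :
  0 <= r ->
  (forall k, `|c k| <= M * (r ^+ k / k`!%:R)) -> cvgn (series c).
Proof.
move=> r0 cle.
(* The term of index 0 forces [M] to be nonnegative, hence real, so that the comparison is with a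
   real exponential series. *)
have M0 : 0 <= M.
  apply: le_trans (normr_ge0 _) _; apply: le_trans (cle 0%N) _.
  by rewrite expr0 fact0 divr1 mulr1.
have cE (z : C) : 0 <= z -> z = (complex.Re z)%:C.
  by move=> z0; rewrite RRe_real// ger0_real.
apply: (@complex_series_cvg _ (fun k => complex.Re M * exp_coeff (complex.Re r) k)).
  move=> k; apply: le_trans (cle k) _.
  rewrite /exp_coeff [X in X * (_ / _)]cE// [X in X ^+ _]cE//.
  by rewrite !rmorphM rmorphXn fmorphV rmorph_nat.
exact: is_cvg_seriesZ (is_cvg_series_exp_coeff _).
Qed.

End ComplexSeries.

(** * From the semigroup to its generator *)

Section DetailedBalance.
Variables (R : realType) (d : nat).
Local Notation C := (R[i]).
Local Notation op := 'M[C]_d.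
Implicit Types (x y z : op) (L : op -> op).

Lemma complex_exp_complete : exp_complete (R[i] : numFieldType).
Proof. exact: complex_exp_series_cvg. Qed.

Lemma qms_trace_cvg L (t : R) (A y : op) : linear L ->
  (series (fun k => t%:C ^+ k / k`!%:R * \tr (A *m iter k L y) : (C : numFieldType)) @ \oo -->
    (\tr (A *m qms L t y) : (C : numFieldType)))%classic.
Proof. exact: (exp_semigroup_trace_cvg complex_exp_complete). Qed.

Lemma qms_trace_eq L (t : R) (A A' y y' : op) : linear L ->
  (forall k, \tr (A *m iter k L y) = \tr (A' *m iter k L y')) ->
  \tr (A *m qms L t y) = \tr (A' *m qms L t y').
Proof.
move=> linL eqk.
have c1 := @qms_trace_cvg L t A y linL; have c2 := @qms_trace_cvg L t A' y' linL.
by apply: cvg_series_unique c1 c2 => k; rewrite eqk.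
Qed.

(** Passage from the semigroup to the generator: the difference of the two power series vanishes for
    all [t >= 0], hence so does its coefficient of order 1. *)
Lemma qms_trace_eq_generator L (A A' y y' : op) : linear L ->
  (forall t : R, 0 <= t -> \tr (A *m qms L t y) = \tr (A' *m qms L t y')) ->
  \tr (A *m L y) = \tr (A' *m L y').
Proof.
move=> linL eqt; apply/eqP; rewrite -subr_eq0; apply/eqP.
have [M [r [M0 r0 bound]]] := trace_iter_le A y linL.
have [M' [r' [M'0 r'0 bound']]] := trace_iter_le A' y' linL.
pose b k := \tr (A *m iter k L y) - \tr (A' *m iter k L y').
apply: (exp_series_coef1_eq0 complex_exp_complete (b := b) (M := M + M')
  (addr_ge0 r0 r'0)).
  move=> k; apply: le_trans (ler_normB _ _) _; rewrite mulrDl lerD//.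
    apply: le_trans (bound k) _.
    by rewrite ler_wpM2l// lerXn2r ?qualifE/= ?addr_ge0// lerDl.
  apply: le_trans (bound' k) _.
  by rewrite ler_wpM2l// lerXn2r ?qualifE/= ?addr_ge0// lerDr.
move=> t t0; have -> : t = (complex.Re t)%:C by rewrite RRe_real// ger0_real.
have {}t0 : 0 <= complex.Re t by rewrite -ler0c RRe_real// ger0_real.
have c1 := @qms_trace_cvg L (complex.Re t) A y linL.
have c2 := @qms_trace_cvg L (complex.Re t) A' y' linL.
apply: (cvg_series_sub0 _ (eqt _ t0) c1 c2) => k.
by rewrite -mulrBr.
Qed.

Section Form.
Variables (e : 'I_d -> 'cV[C]_d) (p : 'I_d -> R).
Local Notation Theta := (transpose_in e).
Local Notation rh := (diag_in e (fun j => Num.sqrt (p j))).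

Hypothesis ThetaK : involutive Theta.
Hypothesis ThetaM : forall x y, Theta (x *m y) = Theta y *m Theta x.
Hypothesis Theta_tr : forall x, \tr (Theta x) = \tr x.
Hypothesis Theta_rh : Theta rh = rh.

(* The relation T' = Theta T Theta, differentiated at t = 0; [form_Theta] lets one
   eliminate the dual T'. *)
Definition generator_sqdb L := forall x y,
  \tr (rh *m x *m rh *m L y) = \tr (rh *m Theta y *m rh *m L (Theta x)).

(** Apply [Theta] under the trace: it preserves the trace, reverses products and fixes [rh]; then
    rotate cyclically. *)
Lemma form_Theta z y :
  \tr (rh *m Theta z *m rh *m y) = \tr (rh *m Theta y *m rh *m z).
Proof.
rewrite -Theta_tr !ThetaM ThetaK Theta_rh.
by rewrite !mulmxA mxtrace_mulC !mulmxA.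
Qed.

Lemma sqdb_generator L : linear L ->
  sqdb Theta e p (qms L) <-> generator_sqdb L.
Proof.
move=> linL; split=> [[T' [dual T'E]] x y | gsym].
  apply: qms_trace_eq_generator linL _ => t t0.
  have e1 := congr1 (fun z => \tr (rh *m z *m rh *m y)) (T'E t t0 x).
  exact: etrans (dual t t0 x y) (etrans e1 (form_Theta _ _)).
exists (fun t x => Theta (qms L t (Theta x))); split=> // t t0 x y.
apply: (etrans _ (esym (form_Theta _ _))); apply: qms_trace_eq linL _ => k.
(* The symmetry passes to all powers of [L]: [gsym] and [form_Theta] move the outermost [L] to the
   other argument, and the induction hypothesis is used with [Theta (L (Theta x))] in place of
   [x]. *)
elim: k x y => [|k IHk] x y.
  by have := form_Theta (Theta x) y; rewrite ThetaK.
rewrite iterS; apply: etrans (gsym _ _) _.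
apply: etrans (form_Theta _ _) _; apply: etrans (IHk _ _) _.
by rewrite ThetaK iterSr.
Qed.

End Form.
End DetailedBalance.

(** * Operators in an orthonormal basis *)

(* Over R[i], failed unifications of matrix expressions diverge when these are
   unfolded. *)
#[local] Opaque mulmx mxtrace.

(* [gksl] with the scalars and the adjoint W of V abstracted. *)
Definition lindblad (K : pzRingType) (n : nat) (c1 c2 c3 : K) (H V W x : 'M[K]_n) :=
  c1 *: (H *m x - x *m H)
  - c2 *: (W *m V *m x - 2 *: (W *m x *m V) + x *m W *m V)
  - c3 *: (V *m W *m x - 2 *: (V *m x *m W) + x *m V *m W).

Lemma lindblad_linear (K : comPzRingType) (n : nat) (c1 c2 c3 : K) (H V W : 'M[K]_n) :
  linear (lindblad c1 c2 c3 H V W).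
Proof.
move=> a x y; rewrite /lindblad.
rewrite !(mulmxDr, mulmxDl, =^~scalemxAr, =^~scalemxAl).
(* With the products generalized to arbitrary matrices, a ring identity between entries remains. *)
move: (H *m x) (H *m y) (x *m H) (y *m H) (W *m V *m x) (W *m V *m y).
move: (W *m x *m V) (W *m y *m V) (x *m W *m V) (y *m W *m V).
move: (V *m W *m x) (V *m W *m y) (V *m x *m W) (V *m y *m W).
move: (x *m V *m W) (y *m V *m W) => *.
by apply/matrixP => i j; rewrite !mxE; ring.
Qed.

Lemma lindblad1 (K : pzRingType) (n : nat) (c1 c2 c3 : K) (H V W : 'M[K]_n) :
  lindblad c1 c2 c3 H V W 1%:M = 0.
Proof.
have zero (A : 'M[K]_n) : A - 2 *: A + A = 0.
  by rewrite addrAC scaler_nat mulr2n subrr.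
by rewrite /lindblad !mulmx1 !mul1mx subrr !zero !scaler0 !subr0.
Qed.

Lemma lindbladN (K : pzRingType) (n : nat) (c1 c2 c3 : K) (H V W x : 'M[K]_n) :
  lindblad (- c1) c2 c3 H V W x =
  c1 *: (x *m H - H *m x)
  - c2 *: (W *m V *m x - 2 *: (W *m x *m V) + x *m W *m V)
  - c3 *: (V *m W *m x - 2 *: (V *m x *m W) + x *m V *m W).
Proof. by congr (_ - _ - _); rewrite scaleNr -scalerN opprB. Qed.

Lemma linear_lindblad_combination (K : pzRingType) (U V : lmodType K)
    (f : {linear U -> V}) (c1 c2 c3 : K) (A B X Y Z S T W : U) :
  f (c1 *: (A - B) - c2 *: (X - 2 *: Y + Z) - c3 *: (S - 2 *: T + W)) =
  c1 *: (f A - f B) - c2 *: (f X - 2 *: f Y + f Z)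
  - c3 *: (f S - 2 *: f T + f W).
Proof. by rewrite !(linearB, linearD, linearZ). Qed.

(** An antimorphism exchanging [V] and [W] fixes [W *m V] and [V *m W], swaps the two halves of each
    anticommutator and preserves the jump terms. Only the commutator with [H] changes sign. *)
Lemma lindblad_antimorphism (K : pzRingType) (n : nat)
    (T : {linear 'M[K]_n -> 'M[K]_n}) (c1 c2 c3 : K) (H V W x : 'M[K]_n) :
  (forall y z, T (y *m z) = T z *m T y) -> involutive T -> T H = H -> T V = W ->
  T (lindblad c1 c2 c3 H V W (T x)) = lindblad (- c1) c2 c3 H V W x.
Proof.
move=> TM TK TH TV; have TW : T W = V by rewrite -TV TK.
rewrite lindbladN /lindblad linear_lindblad_combination !TM TH TV TW (TK x) !mulmxA.
have swap (A B C : 'M[K]_n) : A - B + C = C - B + A.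
  by rewrite addrAC [A + C]addrC addrAC.
congr (_ - _ *: _ - _ *: _); exact: swap.
Qed.

Lemma conj_mulmx (K : pzRingType) (n : nat) (A B x y : 'M[K]_n) : B *m A = 1%:M ->
  A *m (x *m y) *m B = (A *m x *m B) *m (A *m y *m B).
Proof. by move=> BA; rewrite !mulmxA -[_ *m B *m A]mulmxA BA mulmx1. Qed.

Section Basis.
Variables (R : realType) (d : nat).
Local Notation C := (R[i]).
Local Notation op := 'M[C]_d.
Implicit Types (x y z V H : op).
Variables (e : 'I_d -> 'cV[C]_d).
Hypothesis one : orthonormal_basis e.

Definition basis_mx : op := \matrix_(i, j) e j i 0.
Local Notation U := basis_mx.

Lemma matrix_inE x : matrix_in e x = U ^t* *m x *m U.
Proof.
apply/matrixP => j k; rewrite mxE /inner -mulmxA !mxE.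
apply: eq_bigr => i _; rewrite !mxE; congr (_ * _).
by apply: eq_bigr => l _; rewrite !mxE.
Qed.

Lemma basis_mx_unitary : U ^t* *m U = 1%:M.
Proof.
rewrite -[U ^t*]mulmx1 -matrix_inE; apply/matrixP => j k.
by rewrite mxE mul1mx one mxE.
Qed.

Lemma basis_mx_unitaryC : U *m U ^t* = 1%:M.
Proof. exact: mulmx1C basis_mx_unitary. Qed.

Lemma matrix_in_inj : injective (matrix_in e).
Proof.
move=> x y; rewrite !matrix_inE => /(congr1 (fun z => U *m z *m U ^t*)).
by rewrite !mulmxA !basis_mx_unitaryC !mul1mx -!mulmxA basis_mx_unitaryC !mulmx1.
Qed.

Lemma matrix_inM x y : matrix_in e (x *m y) = matrix_in e x *m matrix_in e y.
Proof. by rewrite !matrix_inE (conj_mulmx x y basis_mx_unitaryC). Qed.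

Lemma matrix_in_linear : linear (matrix_in e).
Proof.
by move=> a x y; rewrite !matrix_inE mulmxDr mulmxDl -scalemxAr -scalemxAl.
Qed.
HB.instance Definition _ := GRing.isLinear.Build _ _ _ _ (matrix_in e) matrix_in_linear.

Lemma matrix_inZ a x : matrix_in e (a *: x) = a *: matrix_in e x.
Proof. by rewrite linearZ. Qed.

Lemma conj_trmxK (m n : nat) (A : 'M[C]_(m, n)) : (A ^t*) ^t* = A.
Proof. by apply/matrixP => i j; rewrite !mxE conjCK. Qed.

Lemma conj_trmxM (m n q : nat) (A : 'M[C]_(m, n)) (B : 'M[C]_(n, q)) :
  (A *m B) ^t* = B ^t* *m A ^t*.
Proof. by rewrite trmx_mul map_mxM. Qed.

Lemma matrix_in_adj x : matrix_in e (x ^t*) = (matrix_in e x) ^t*.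
Proof. by rewrite !matrix_inE !conj_trmxM conj_trmxK mulmxA. Qed.

Lemma matrix_in_tr x : \tr (matrix_in e x) = \tr x.
Proof. by rewrite matrix_inE mxtrace_mulC mulmxA basis_mx_unitaryC mul1mx. Qed.

Lemma matrix_in_ketbra j k : matrix_in e (ketbra (e j) (e k)) = delta_mx j k.
Proof.
apply/matrixP => a b; rewrite [LHS]mxE /inner /ketbra -!mulmxA (mulmxA (e a ^t*)).
rewrite [LHS]mxE big_ord1.
have -> : (e a ^t* *m e j) 0 0 = (a == j)%:R by exact: one.
have -> : (e k ^t* *m e b) 0 0 = (k == b)%:R by exact: one.
by rewrite mxE [k == b]eq_sym -natrM mulnb.
Qed.

(** With the injectivity of [matrix_in], this carries the rules of ordinary transposition over to
    [transpose_in]. *)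
Lemma matrix_in_transpose x : matrix_in e (transpose_in e x) = (matrix_in e x)^T.
Proof.
rewrite /transpose_in linear_sum [RHS]matrix_sum_delta; apply: eq_bigr => j _.
rewrite linear_sum; apply: eq_bigr => k _.
by rewrite linearZ /= matrix_in_ketbra.
Qed.

Lemma matrix_in_diag (f : 'I_d -> R) :
  matrix_in e (diag_in e f) = diag_mx (\row_j (f j)%:C).
Proof.
rewrite /diag_in linear_sum diag_mx_sum_delta; apply: eq_bigr => j _.
by rewrite linearZ /= matrix_in_ketbra mxE.
Qed.

#[local] Opaque matrix_in transpose_in diag_in.

Lemma transpose_inK : involutive (transpose_in e).
Proof. by move=> x; apply: matrix_in_inj; rewrite !matrix_in_transpose trmxK. Qed.

Lemma transpose_inM x y :
  transpose_in e (x *m y) = transpose_in e y *m transpose_in e x.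
Proof.
apply: matrix_in_inj; rewrite matrix_in_transpose !matrix_inM !matrix_in_transpose.
exact: trmx_mul.
Qed.

Lemma transpose_in1 : transpose_in e 1%:M = 1%:M.
Proof.
have one_in : matrix_in e 1%:M = 1%:M.
  by rewrite matrix_inE (mulmx1 (U ^t*)); exact: basis_mx_unitary.
by apply: matrix_in_inj; rewrite matrix_in_transpose one_in trmx1.
Qed.

Lemma transpose_in_linear : linear (transpose_in e).
Proof.
move=> a x y; apply: matrix_in_inj.
rewrite matrix_in_transpose (linearP (matrix_in e)) [RHS]linearP /=.
by rewrite (matrix_in_transpose x) (matrix_in_transpose y); exact: linearP.
Qed.

Lemma transpose_inZ a x : transpose_in e (a *: x) = a *: transpose_in e x.
Proof.
apply: matrix_in_inj.
rewrite matrix_inZ (matrix_in_transpose x) matrix_in_transpose matrix_inZ.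
exact: linearZ.
Qed.

Lemma transpose_in_tr x : \tr (transpose_in e x) = \tr x.
Proof. by rewrite -matrix_in_tr matrix_in_transpose mxtrace_tr matrix_in_tr. Qed.

Lemma transpose_in_diag (f : 'I_d -> R) : transpose_in e (diag_in e f) = diag_in e f.
Proof.
by apply: matrix_in_inj; rewrite matrix_in_transpose !matrix_in_diag tr_diag_mx.
Qed.

Lemma transpose_in_real x : matrix_in e x \is a realmx -> transpose_in e x = x ^t*.
Proof.
move=> /mxOverP xreal; apply: matrix_in_inj.
rewrite matrix_in_transpose matrix_in_adj.
by apply/matrixP => i j; rewrite !mxE (CrealP _) //; have := xreal j i; rewrite mxE.
Qed.

Lemma diag_in_adj (f : 'I_d -> R) : (diag_in e f) ^t* = diag_in e f.
Proof.
apply: matrix_in_inj; rewrite matrix_in_adj !matrix_in_diag.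
apply/matrixP => i j; rewrite !mxE [j == i]eq_sym; case: eqP => [->|_].
  by rewrite !mulr1n; exact: conjc_real.
by rewrite !mulr0n conjC0.
Qed.

Lemma gkslE H V (gm gp : R) x :
  gksl H V gm gp x = lindblad 'i%C (gm%:C / 2) (gp%:C / 2) H V (V ^t*) x.
Proof. by rewrite /gksl !rmorphM !fmorphV !rmorph_nat. Qed.

Lemma linear_gksl H V (gm gp : R) : linear (gksl H V gm gp).
Proof. by move=> a x y; rewrite !gkslE; exact: lindblad_linear. Qed.

Lemma gksl1 H V (gm gp : R) : gksl H V gm gp 1%:M = 0.
Proof. by rewrite gkslE lindblad1. Qed.

Lemma matrix_in_gksl H V (gm gp : R) x :
  matrix_in e (gksl H V gm gp x) =
  gksl (matrix_in e H) (matrix_in e V) gm gp (matrix_in e x).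
Proof.
rewrite /gksl (linear_lindblad_combination (matrix_in e)) /=.
by rewrite !matrix_inM matrix_in_adj.
Qed.

(** Row and column [k] of the projection vanish, so the commutator and the anticommutators
    contribute nothing at [(k, k)]. The jump terms leave a classical transition rate. *)
Lemma gksl_delta_diag H V (gm gp : R) (a k : 'I_d) : a != k ->
  gksl H V gm gp (delta_mx a a) k k =
  gm%:C * `|V a k| ^+ 2 + gp%:C * `|V k a| ^+ 2.
Proof.
move=> ak.
have r0 (A : op) : (A *m delta_mx a a) k k = 0.
  rewrite mxE big1// => i _; rewrite mxE [k == a]eq_sym (negPf ak) andbF mulr0//.
have l0 (A : op) : (delta_mx a a *m A) k k = 0.
  rewrite mxE big1// => i _; rewrite mxE [k == a]eq_sym (negPf ak) mul0r//.
have s (A B : op) : (A *m delta_mx a a *m B) k k = A k a * B a k.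
  rewrite mxE (bigD1 a)//= big1 ?addr0 => [|i ia].
    rewrite mxE (bigD1 a)//= big1 ?addr0 => [|i ia]; first by rewrite mxE !eqxx mulr1.
    by rewrite mxE (negPf ia) mulr0.
  rewrite mxE big1 ?mul0r// => j _; rewrite mxE (negPf ia) andbF mulr0//.
have ent (A B X Y Z X' Y' Z' : op) (c1 c2 c3 : C) :
    (c1 *: (A - B) - c2 *: (X - 2 *: Y + Z) - c3 *: (X' - 2 *: Y' + Z')) k k =
    c1 * (A k k - B k k) - c2 * (X k k - 2 * Y k k + Z k k)
    - c3 * (X' k k - 2 * Y' k k + Z' k k) by rewrite !mxE.
rewrite /gksl -[delta_mx a a *m V ^t* *m V]mulmxA -[delta_mx a a *m V *m V ^t*]mulmxA.
rewrite ent !r0 !l0 !s !normCK !mxE rmorphM rmorphM fmorphV /= !rmorph_nat.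
by field.
Qed.

(** Each [e j], being an eigenvector of [HS], lies in the range of a single projection [P (n j)],
    because the [eps] are distinct. Hence the entry [(a, k)] sees only the pair [(n k, n a)] of the
    double sum. *)
Lemma spectral_support (N : nat) (eps : 'I_N -> R) (P : 'I_N -> op) HS V :
  spectral_decomposition eps P HS ->
  (forall j, exists a : C, HS *m e j = a *: e j) ->
  exists n : 'I_d -> 'I_N, forall w a k,
    matrix_in e (bohr_component eps P V w) a k != 0 -> eps (n k) - eps (n a) = w.
Proof.
move=> [eps_inj Pherm PP Psum HSE] eig.
have Padj m : (P m) ^t* = P m.
  have [/is_hermitianmxP Pm _] := Pherm m.
  by rewrite [RHS]Pm expr0 scale1r.
have block j : exists n, forall m, m != n -> P m *m e j = 0.
  have [a HSe] := eig j.
  have Pe m : ((eps m)%:C - a) *: (P m *m e j) = 0.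
    have : P m *m (HS *m e j) = (eps m)%:C *: (P m *m e j).
      rewrite HSE mulmxA mulmx_sumr (bigD1 m)//= big1 => [|l lm].
        by rewrite addr0 -scalemxAr PP eqxx scalemxAl.
      by rewrite -scalemxAr PP eq_sym (negPf lm) scaler0.
    by rewrite HSe -scalemxAr scalerBl => ->; rewrite subrr.
  (* If all projections killed [e j], the resolution of the identity would contradict its norm being
     1. *)
  have [n nz] : exists n, P n *m e j != 0.
    apply/existsP; rewrite -negb_forall; apply/negP => /forallP all0.
    have := one j j; rewrite eqxx /inner -[X in _ *m X]mul1mx -Psum mulmx_suml.
    rewrite big1 => [|m _]; last exact/eqP.
    by rewrite mulmx0 mxE => /eqP; rewrite eq_sym oner_eq0.
  exists n => m mn; have := Pe m; have := Pe n.
  move/eqP; rewrite scaler_eq0 (negPf nz) orbF subr_eq0 => /eqP <-.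
  move/eqP; rewrite scaler_eq0 -rmorphB fmorph_eq0 subr_eq0 => /orP[/eqP/eps_inj|/eqP//].
  by move/eqP; rewrite (negPf mn).
have [n nP] := choice block; exists n => w a k; apply: contraNeq => ne.
rewrite mxE /inner /bohr_component mulmx_suml mulmx_sumr summxE big1// => l _.
have [->|lk] := eqVneq l (n k); last first.
  rewrite mulmx_suml mulmx_sumr summxE big1// => m _.
  by rewrite -[_ *m e k]mulmxA nP// !mulmx0 mxE.
rewrite mulmx_suml mulmx_sumr summxE big1// => m mw.
have mna : m != n a by apply: contraNneq ne => <-.
rewrite -!mulmxA [e a ^t* *m _]mulmxA.
have -> : e a ^t* *m P m = 0.
  by rewrite -[P m]Padj -conj_trmxM nP// trmx0 map_mx0.
by rewrite mul0mx mxE.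
Qed.

End Basis.

(** * The detailed balance symmetry of the generator *)

Section WeightedTraceForm.
Variables (K : fieldType) (n : nat).
Implicit Types (r D H V W x y : 'M[K]_n).

Lemma weighted_trace_commute r D x y : comm_mx r D ->
  \tr (r *m x *m r *m (D *m y)) = \tr (r *m (x *m D) *m r *m y) /\
  \tr (r *m x *m r *m (y *m D)) = \tr (r *m (D *m x) *m r *m y).
Proof.
move=> rD; split; first by rewrite -!mulmxA [r *m (D *m _)]mulmxA rD !mulmxA.
by rewrite mulmxA mxtrace_mulC !mulmxA -rD.
Qed.

(** Cyclicity brings [W] to the front; carrying [W] and [V] each past one factor [r] costs [c]
    twice. *)
Lemma weighted_trace_jump r V W c x y : c != 0 ->
  r *m V = c *: (V *m r) -> W *m r = c *: (r *m W) ->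
  \tr (r *m x *m r *m (V *m y *m W)) = c ^+ 2 * \tr (r *m (W *m x *m V) *m r *m y).
Proof.
move=> c0 rV Wr.
rewrite !mulmxA mxtrace_mulC !mulmxA Wr.
rewrite -!scalemxAl mxtraceZ -[_ *m r *m V]mulmxA rV -scalemxAr -scalemxAl mxtraceZ.
by rewrite mulrA -expr2 !mulmxA.
Qed.

Lemma scaled_commutation_inv r V W c : c != 0 ->
  r *m V = c *: (V *m r) -> W *m r = c *: (r *m W) ->
  V *m r = c^-1 *: (r *m V) /\ r *m W = c^-1 *: (W *m r).
Proof. by move=> c0 -> ->; rewrite !scalerA !mulVf// !scale1r. Qed.

Lemma scaled_commutation_comm_mx r V W c : c != 0 ->
  r *m V = c *: (V *m r) -> W *m r = c *: (r *m W) ->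
  comm_mx r (W *m V) /\ comm_mx r (V *m W).
Proof.
move=> c0 rV Wr; have [_ rW] := scaled_commutation_inv c0 rV Wr.
rewrite /comm_mx; split; rewrite mulmxA ?rV ?rW.
  by rewrite -scalemxAl -mulmxA rV -scalemxAr scalerA mulVf// scale1r mulmxA.
by rewrite -scalemxAl -mulmxA rW -scalemxAr scalerA mulfV// scale1r mulmxA.
Qed.

(** Taking adjoints for the weighted form exchanges the two jump terms, and the factor [c ^+ 2]
    turns the rate [gp] into [gm]. The anticommutators are self-adjoint, as [W *m V] and [V *m W]
    commute with [r]; the commutator changes sign. *)
Lemma lindblad_trace_adjoint r H V W (c c1 gm gp : K) x y : c != 0 ->
  gm = c ^+ 2 * gp -> r *m V = c *: (V *m r) -> W *m r = c *: (r *m W) ->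
  comm_mx r H -> (2 : K) != 0 ->
  \tr (r *m x *m r *m lindblad c1 (gm / 2) (gp / 2) H V W y) =
  \tr (r *m lindblad (- c1) (gm / 2) (gp / 2) H V W x *m r *m y).
Proof.
move=> c0 gmE rV Wr rH two.
have [Vr rW] := scaled_commutation_inv c0 rV Wr.
have [rWV rVW] := scaled_commutation_comm_mx c0 rV Wr.
have [h1 h2] := weighted_trace_commute x y rH.
have [m1 m2] := weighted_trace_commute x y rWV.
have [p1 p2] := weighted_trace_commute x y rVW.
have jp := weighted_trace_jump x y c0 rV Wr.
have ci0 : c^-1 != 0 by rewrite invr_eq0.
(* The opposite jump is the same fact with [V] and [W] exchanged and [c] inverted. *)
have jm := weighted_trace_jump x y ci0 rW Vr.
pose f : {linear 'M[K]_n -> K^o} := mxtrace \o mulmx (r *m x *m r).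
pose g : {linear 'M[K]_n -> K^o} := mxtrace \o (mulmxr y \o (mulmxr r \o mulmx r)).
rewrite lindbladN /lindblad -[LHS]/(f _) -[RHS]/(g _) !linear_lindblad_combination.
rewrite /f /g /= -[y *m W *m V]mulmxA -[y *m V *m W]mulmxA.
rewrite -[x *m W *m V]mulmxA -[x *m V *m W]mulmxA.
rewrite h1 h2 m1 m2 p1 p2 jp jm gmE /GRing.scale /=.
by field; rewrite two c0.
Qed.

End WeightedTraceForm.

#[local] Opaque matrix_in transpose_in diag_in.

Lemma mxtrace_mulmx_sum (K : pzRingType) (n : nat) (I : Type) (s : seq I)
    (A : 'M[K]_n) (F : I -> 'M[K]_n) :
  \tr (A *m \sum_(i <- s) F i) = \sum_(i <- s) \tr (A *m F i).
Proof. by rewrite mulmx_sumr raddf_sum. Qed.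

Lemma mxtrace_diag_delta (K : comPzRingType) (n : nat) (f : 'rV[K]_n)
    (X : 'M[K]_n) k :
  \tr (diag_mx f *m delta_mx k k *m diag_mx f *m X) = f 0 k ^+ 2 * X k k.
Proof.
have -> : diag_mx f *m delta_mx k k *m diag_mx f = f 0 k ^+ 2 *: delta_mx k k.
  apply/matrixP => i j; rewrite mul_mx_diag mul_diag_mx !mxE.
  have [->|_] := eqVneq i k; have [->|_] := eqVneq j k;
    by rewrite ?(mulr1, mulr0, mul0r).
by rewrite -scalemxAl mxtraceZ trace_delta_mul.
Qed.

Lemma big_seq_single (U : nmodType) (I : eqType) (s : seq I) (i : I) (F : I -> U) :
  uniq s -> i \in s -> (forall j, j \in s -> j != i -> F j = 0) ->
  \sum_(j <- s) F j = F i.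
Proof.
move=> s_uniq si F0; rewrite (bigD1_seq i)//= big_seq_cond big1 ?addr0// => j.
by move=> /andP[sj ji]; exact: F0.
Qed.

(** * Classical balance and the symmetry of each Bohr component *)

Section Bohr.
Variables (R : realType) (d : nat) (e : 'I_d -> 'cV[R[i]]_d) (p : 'I_d -> R).
Local Notation op := 'M[R[i]]_d.
Local Notation Theta := (transpose_in e).
Local Notation rh := (diag_in e (fun j => Num.sqrt (p j))).
Implicit Types (x y z H V : op) (L : op -> op).
Hypothesis one : orthonormal_basis e.
Hypothesis p_gt0 : forall j, 0 < p j.

Lemma form_transpose z y :
  \tr (rh *m Theta z *m rh *m y) = \tr (rh *m Theta y *m rh *m z).
Proof.
exact: (form_Theta (transpose_inK one) (transpose_inM one) (transpose_in_tr one)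
  (transpose_in_diag one _)).
Qed.

Lemma sqdb_transpose L : linear L ->
  sqdb Theta e p (qms L) <-> generator_sqdb e p L.
Proof.
exact: (sqdb_generator (transpose_inK one) (transpose_inM one)
  (transpose_in_tr one) (transpose_in_diag one _)).
Qed.

Lemma generator_sqdb_sum (I : eqType) (s : seq I) (Ls : I -> op -> op) :
  (forall i, i \in s -> generator_sqdb e p (Ls i)) ->
  generator_sqdb e p (fun x => \sum_(i <- s) Ls i x).
Proof.
move=> gs x y; rewrite !mxtrace_mulmx_sum.
by apply: eq_big_seq => i /gs; apply.
Qed.

Lemma transpose_in_gksl H V (gm gp : R) x : Theta H = H -> Theta V = V ^t* ->
  Theta (gksl H V gm gp (Theta x)) =
  lindblad (- 'i%C) (gm%:C / 2) (gp%:C / 2) H V (V ^t*) x.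
Proof.
move=> TH TV; rewrite gkslE.
pose T : {linear op -> op} :=
  HB.pack Theta (GRing.isLinear.Build _ _ _ _ Theta (transpose_in_linear one)).
exact: (@lindblad_antimorphism _ _ T _ _ _ _ _ _ _
  (transpose_inM one) (transpose_inK one) TH TV).
Qed.

Lemma scaled_commutation_adj V (c : R) : rh *m V = c%:C *: (V *m rh) ->
  V ^t* *m rh = c%:C *: (rh *m V ^t*).
Proof.
move=> /(congr1 (fun A : op => A ^t*)).
rewrite conj_trmxM (diag_in_adj one) => ->.
rewrite linearZ map_mxZ conj_trmxM (diag_in_adj one); congr (_ *: _).
exact: conjc_real.
Qed.

(** Conjugation by [Theta] and the adjoint for the trace form agree on this generator: both only
    reverse the sign of the commutator. *)
Lemma generator_sqdb_gksl H V (gm gp c : R) : c != 0 -> gm = c ^+ 2 * gp ->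
  rh *m V = c%:C *: (V *m rh) -> comm_mx rh H ->
  Theta H = H -> Theta V = V ^t* -> generator_sqdb e p (gksl H V gm gp).
Proof.
move=> c0 gmE rV rH TH TV x y.
have Vr := scaled_commutation_adj rV.
apply: etrans (form_transpose _ _); rewrite transpose_in_gksl// gkslE.
apply: lindblad_trace_adjoint rV Vr rH _; rewrite ?pnatr_eq0//.
  by rewrite fmorph_eq0.
by rewrite gmE rmorphM rmorphXn.
Qed.

Lemma invariant_state_gksl H V (gm gp : R) : density_matrix (diag_in e p) ->
  generator_sqdb e p (gksl H V gm gp) ->
  invariant_state (diag_in e p) (qms (gksl H V gm gp)).
Proof.
move=> rho_dm gs; split=> // t x t0.
have linL := linear_gksl H V gm gp.
have rhoE : diag_in e p = rh *m 1%:M *m rh.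
  apply: (matrix_in_inj one); rewrite mulmx1 (matrix_inM one) !(matrix_in_diag one).
  rewrite mulmx_diag; congr diag_mx; apply/rowP => j; rewrite !mxE.
  by rewrite -rmorphM -expr2 sqr_sqrtr// ltW.
(* Symmetry at [x = 1] moves the generator onto [Theta 1 = 1], where it vanishes. So only the term
   of order 0 of the exponential series survives. *)
have L0 z : \tr (diag_in e p *m gksl H V gm gp z) = 0.
  by rewrite rhoE gs transpose_in1// gksl1 mulmx0 mxtrace0.
have /cvg_series_head -> := @qms_trace_cvg _ _ _ t (diag_in e p) x linL.
  by rewrite expr0 fact0 divr1 mul1r.
by move=> k; rewrite iterS L0 mulr0.
Qed.

(** At a nonzero entry [(a, k)] the claim is the square root of the balance equation; at a zero
    entry it is trivial. *)
Lemma detailed_balance_commutation V (gm gp : R) : 0 < gm -> 0 < gp ->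
  (forall a k, matrix_in e V a k != 0 -> gm * p k = gp * p a) ->
  rh *m V = (Num.sqrt (gm / gp))%:C *: (V *m rh).
Proof.
move=> gm0 gp0 db; apply: (matrix_in_inj one).
rewrite matrix_inZ !(matrix_inM one) (matrix_in_diag one).
apply/matrixP => a k; rewrite mul_diag_mx mul_mx_diag !mxE mulrC mulrA mulrAC.
have := db a k; rewrite [matrix_in _ _ _ _]mxE; case: eqP => [->|_ /(_ isT) dbE].
  by rewrite !(mul0r, mulr0).
rewrite mulrC; congr (_ * _); rewrite -rmorphM -sqrtrM ?divr_ge0 ?ltW//.
by rewrite mulrAC dbE mulrAC mulfV ?mul1r ?gt_eqF.
Qed.

(** Since [H] is a combination of [V ^t* *m V] and [V *m V ^t*], it inherits from them that it
    commutes with [rh] and is fixed by [Theta]. The latter uses that [V] is real, so that [Theta V]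
    is its adjoint. *)
Lemma generator_sqdb_balanced H V (gm gp : R) : 0 < gm -> 0 < gp ->
  matrix_in e V \is a realmx ->
  (exists a b : R[i], H = a *: (V ^t* *m V) + b *: (V *m V ^t*)) ->
  (forall a k, matrix_in e V a k != 0 -> gm * p k = gp * p a) ->
  generator_sqdb e p (gksl H V gm gp).
Proof.
move=> gm0 gp0 Vreal [a [b HE]] db.
have c0 : Num.sqrt (gm / gp) != 0 by rewrite gt_eqF// sqrtr_gt0 divr_gt0.
have c0' : (Num.sqrt (gm / gp))%:C != 0 :> R[i] by rewrite fmorph_eq0.
have rV := detailed_balance_commutation gm0 gp0 db.
have TV := transpose_in_real one Vreal.
have Vr := scaled_commutation_adj rV.
have TVa : Theta (V ^t*) = V by rewrite -TV transpose_inK.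
apply: (generator_sqdb_gksl c0 _ rV _ _ TV).
- by rewrite sqr_sqrtr ?divr_ge0 ?ltW// divfK ?gt_eqF.
- have [h1 h2] := scaled_commutation_comm_mx c0' rV Vr.
  by rewrite HE /comm_mx mulmxDr mulmxDl -!scalemxAr -!scalemxAl h1 h2.
rewrite HE (transpose_in_linear one) !(transpose_inZ one).
by rewrite !(transpose_inM one) TV TVa.
Qed.

Lemma transition_rate H V (gm gp : R) a k : a != k ->
  \tr (rh *m ketbra (e k) (e k) *m rh *m gksl H V gm gp (ketbra (e a) (e a))) =
  (p k)%:C * (gm%:C * `|matrix_in e V a k| ^+ 2 + gp%:C * `|matrix_in e V k a| ^+ 2).
Proof.
move=> ak; rewrite -(gksl_delta_diag (matrix_in e H) _ _ _ ak).
rewrite -(matrix_in_ketbra one) -(matrix_in_gksl one).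
rewrite -(matrix_in_tr one) !(matrix_inM one) (matrix_in_diag one).
rewrite (matrix_in_ketbra one k k).
rewrite mxtrace_diag_delta mxE; congr (_ * _).
by rewrite -rmorphXn sqr_sqrtr// ltW.
Qed.

Lemma transpose_in_ketbra k : Theta (ketbra (e k) (e k)) = ketbra (e k) (e k).
Proof.
apply: (matrix_in_inj one).
by rewrite matrix_in_transpose// matrix_in_ketbra// trmx_delta.
Qed.

(* [n k] is the energy of [e k]. *)
Lemma generator_sqdb_detailed_balance (ws : seq R) (Vw Hw : R -> op) (gm gp : R -> R)
    (n : 'I_d -> R) :
  uniq ws -> (forall w, w \in ws -> 0 < w) ->
  (forall w a k, matrix_in e (Vw w) a k != 0 -> n k - n a = w) ->
  generator_sqdb e p (fun x => \sum_(w <- ws) gksl (Hw w) (Vw w) (gm w) (gp w) x) ->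
  forall w a k, w \in ws -> matrix_in e (Vw w) a k != 0 -> gm w * p k = gp w * p a.
Proof.
move=> ws_uniq ws_gt0 supp gs w a k w_ws Vak.
have wE := supp _ _ _ Vak.
have ak : a != k.
  by apply: contraTneq (ws_gt0 w w_ws) => ak; rewrite -wE ak subrr ltxx.
have other_ak w' : w' != w -> matrix_in e (Vw w') a k = 0.
  by move=> w'w; apply: contra_neq_eq w'w => /supp <-.
(* A nonzero entry [(k, a)] would force the frequency [w' = - w], which is negative. *)
have V_ka w' : w' \in ws -> matrix_in e (Vw w') k a = 0.
  move=> w'_ws; apply/eqP; apply: contraTT (ws_gt0 w w_ws) => /supp w'E.
  by rewrite -wE -opprB w'E oppr_gt0 -leNgt ltW// ws_gt0.
pose E j := ketbra (e j) (e j).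
pose rate b c w' :=
  \tr (rh *m E b *m rh *m gksl (Hw w') (Vw w') (gm w') (gp w') (E c)).
have rate_ak : \sum_(w' <- ws) rate k a w' =
    (p k)%:C * ((gm w)%:C * `|matrix_in e (Vw w) a k| ^+ 2).
  rewrite (big_seq_single ws_uniq w_ws) => [|w' w'_ws w'w];
    rewrite [LHS]transition_rate//.
    by rewrite V_ka// normr0 expr0n mulr0 addr0.
  by rewrite other_ak// V_ka// normr0 expr0n !mulr0 addr0 mulr0.
have rate_ka : \sum_(w' <- ws) rate a k w' =
    (p a)%:C * ((gp w)%:C * `|matrix_in e (Vw w) a k| ^+ 2).
  have ka : k != a by rewrite eq_sym.
  rewrite (big_seq_single ws_uniq w_ws) => [|w' w'_ws w'w];
    rewrite [LHS]transition_rate//.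
    by rewrite V_ka// normr0 expr0n mulr0 add0r.
  by rewrite other_ak// V_ka// normr0 expr0n !mulr0 addr0 mulr0.
(* [Theta] fixes both projections, so the symmetry of the full generator simply exchanges [k] and
   [a]. *)
have rates : \sum_(w' <- ws) rate k a w' = \sum_(w' <- ws) rate a k w'.
  have := gs (E k) (E a).
  have TEk : Theta (E k) = E k := transpose_in_ketbra k.
  have TEa : Theta (E a) = E a := transpose_in_ketbra a.
  rewrite /rate; move: (E k) (E a) TEk TEa {rate_ak rate_ka} => Ek Ea -> -> h.
  apply: etrans (esym (mxtrace_mulmx_sum _ _ _)) _.
  exact: etrans h (mxtrace_mulmx_sum _ _ _).
have nz : `|matrix_in e (Vw w) a k| ^+ 2 != 0 by rewrite expf_eq0 normr_eq0.
have := etrans (esym rate_ak) (etrans rates rate_ka).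
rewrite (mulrA (p k)%:C) (mulrA (p a)%:C) => /(mulIf nz).
by rewrite -!rmorphM => /complexI; rewrite mulrC => ->; rewrite mulrC.
Qed.

End Bohr.

Theorem theorem6 (R : realType) (d N : nat)
    (HS : 'M[R[i]]_d) (eps : 'I_N -> R) (P : 'I_N -> 'M[R[i]]_d)
    (V : 'M[R[i]]_d) (H : R -> 'M[R[i]]_d) (gm gp : R -> R)
    (e : 'I_d -> 'cV[R[i]]_d) (p : 'I_d -> R) :
  let bohr := bohr_frequencies eps in
  let Vw := bohr_component eps P V in
  let Lw := fun w => gksl (H w) (Vw w) (gm w) (gp w) in
  let L := fun x => \sum_(w <- bohr) Lw w x in
  let rho := diag_in e p in
  let Theta := transpose_in e in
  HS \is hermsymmx ->
  spectral_decomposition eps P HS ->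
  (forall w, w \in bohr ->
     [/\ H w \is hermsymmx, comm_mx (H w) HS, 0 < gm w & 0 < gp w]) ->
  free (kraus bohr Vw gm gp) ->
  orthonormal_basis e ->
  (forall j, exists a : R[i], HS *m e j = a *: e j) ->
  (forall j, 0 < p j) ->
  \sum_j p j = 1 ->
  comm_mx rho HS ->
  invariant_state rho (qms L) ->
  (forall w, w \in bohr -> matrix_in e (Vw w) \is a realmx) ->
  (forall w, w \in bohr -> exists a b : R[i],
     H w = a *: ((Vw w) ^t* *m Vw w) + b *: (Vw w *m (Vw w) ^t*)) ->
  sqdb Theta e p (qms L)
  <->
  (forall w, w \in bohr ->
     invariant_state rho (qms (Lw w)) /\ sqdb Theta e p (qms (Lw w))).
Proof.
move=> bohr Vw Lw L rho Theta _ spec Hg _ one eig p_gt0 _ _ [rho_dm _] Vreal HV.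
have linLw w : linear (Lw w) := linear_gksl (H w) (Vw w) (gm w) (gp w).
have linL : linear L.
  move=> a x y; rewrite /L scaler_sumr -big_split /=.
  by apply: eq_bigr => w _; exact: linLw.
split=> [/(sqdb_transpose p one linL) gs w w_bohr | allw]; last first.
  apply/(sqdb_transpose p one linL)/generator_sqdb_sum => w w_bohr.
  by apply/(sqdb_transpose p one (linLw w)); have [] := allw w w_bohr.
(* [n k] is the index of the eigenspace containing [e k], so that [eps \o n] gives the energies of
   the basis vectors. *)
have [n nE] := spectral_support one V spec eig.
have bohr_gt0 w' : w' \in bohr -> 0 < w'.
  by rewrite mem_undup mem_filter => /andP[].
have db := generator_sqdb_detailed_balance one p_gt0 (n := eps \o n)
  (undup_uniq _) bohr_gt0 nE gs.
have [_ _ gm0 gp0] := Hg w w_bohr.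
have gsw : generator_sqdb e p (Lw w).
  apply: (generator_sqdb_balanced one gm0 gp0 (Vreal w w_bohr) (HV w w_bohr)).
  by move=> a k; exact: db.
split; first exact: invariant_state_gksl.
by apply/(sqdb_transpose p one (linLw w)).
Qed.
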